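(* Let $n>0$ and $\sigma\in C_{2n}(123)$. The number of right connected components of $\sigma$ equals $2\cdot\mathrm{ret}(\Phi(\sigma))$ if $\Phi(\sigma)$ is a Dyck path, and $2\cdot\mathrm{ret}(\Phi(\sigma))+1$ otherwise.
   Context: $C_{2n}(123)$ is the set of permutations $\sigma$ of $[2n]=\{1,\dots,2n\}$ with $\sigma(i)+\sigma(2n+1-i)=2n+1$ for all $i$ and no $i<j<k$ with $\sigma(i)<\sigma(j)<\sigma(k)$. The connected components of a permutation $\tau$ of $[m]$ are the restrictions of $\tau$ to the blocks of the finest partition of $[m]$ into intervals $I$ with $\tau(I)=I$; the number of right connected components of $\sigma$ is the number of connected components of $\sigma^{rev}$, where $\sigma^{rev}(i)=\sigma(2n+1-i)$. A Dyck prefix of length $m$ is a word in $U=(1,1)$, $D=(1,-1)$ of length $m$ whose lattice path from the origin never goes below the $x$-axis; it is a Dyck path if it ends on the $x$-axis; $\mathrm{ret}(\pi)$ is the number of down steps of $\pi$ ending on the $x$-axis. For a set $S=\{s_1<\dots<s_r\}$ and a permutation $\tau$ of $[r]$, the word on $S$ order-isomorphic to $\tau$ is $s_{\tau(1)}\cdots s_{\tau(r)}$. Define $\Psi$ recursively from Dyck prefixes of length $2n$ to permutations of $[2n]$: the empty prefix goes to the empty permutation; for nonempty $\pi=U^jD^k\pi'$ ($j\ge1,k\ge0$ maximal), $\sigma=\Psi(\pi)$ is: (a) if $j\le n$: $\sigma(1)=2n+1-j$, $\sigma(i)=2n+2-i$ ($2\le i\le k$), $\sigma(2n)=j$, $\sigma(2n-i)=i$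 ($1\le i\le k-1$), and $\sigma(k+1)\cdots\sigma(2n-k)$ is the word on $[2n]\setminus\{1,\dots,k-1,j,2n+1-j,2n-k+2,\dots,2n\}$ order-isomorphic to $\Psi(U^{j-k}\pi')$; (b) if $j=n+1$: $\sigma(1)=n$, $\sigma(i)=2n+2-i$ ($2\le i\le k+1$), $\sigma(2n)=n+1$, $\sigma(2n-i)=i$ ($1\le i\le k$), and $\sigma(k+2)\cdots\sigma(2n-k-1)$ is the word on $[2n]\setminus\{1,\dots,k,n,n+1,2n-k+1,\dots,2n\}$ order-isomorphic to $\Psi(U^{n-k-1}\pi')$; (c) if $j\ge n+2$: $\sigma(1)=n$, $\sigma(2n)=n+1$, and $\sigma(2)\cdots\sigma(2n-1)$ is the word on $[2n]\setminus\{n,n+1\}$ order-isomorphic to $\Psi(U^{j-2}D^k\pi')$. The paper shows $\Psi$ is a bijection onto $C_{2n}(123)$; $\Phi$ denotes its inverse. *)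

(* Defs.v *)
From mathcomp Require Import all_boot all_order all_fingroup all_algebra zify.

Set Implicit Arguments.
Unset Strict Implicit.
Unset Printing Implicit Defensive.

Import GRing.Theory Num.Theory.

(* A permutation of [m] = {1, ..., m} is an element s of 'S_m, a permutation of
   {0, ..., m - 1}: the value s(i + 1) of the text is (s i).+1. *)

Definition oneline (m : nat) (s : 'S_m) : seq nat :=
  [seq (s i).+1 | i <- enum 'I_m].

(* (s * t)%g i = t (s i), so this is the permutation i |-> s (m - 1 - i). *)
Definition perm_rev (m : nat) (s : 'S_m) : 'S_m :=
  (perm (@rev_ord_inj m) * s)%g.

Definition centrosymmetric (m : nat) (s : 'S_m) : bool :=
  [forall i, (s i).+1 + (s (rev_ord i)).+1 == m.+1].

Definition avoids123 (m : nat) (s : 'S_m) : bool :=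
  ~~ [exists i : 'I_m, exists j : 'I_m, exists k : 'I_m,
        [&& i < j, j < k, s i < s j & s j < s k]].

Definition C123 (n : nat) : {set 'S_(2 * n)} :=
  [set s | centrosymmetric s && avoids123 s].

Definition is_interval (m : nat) (B : {set 'I_m}) : bool :=
  [forall x in B, forall z in B, forall y : 'I_m,
     (x <= y <= z) ==> (y \in B)].

Definition invariant_interval_partition (m : nat) (t : 'S_m)
    (P : {set {set 'I_m}}) : bool :=
  partition P [set: 'I_m] && [forall B in P, is_interval B && (t @: B == B)].

Definition refines (m : nat) (P Q : {set {set 'I_m}}) : bool :=
  [forall B in P, exists C in Q, B \subset C].

Definition finest_invariant_interval_partition (m : nat) (t : 'S_m)
    (P : {set {set 'I_m}}) : bool :=
  invariant_interval_partition t P &&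
  [forall Q, invariant_interval_partition t Q ==> refines P Q].

(* The components are represented by their supports. *)
Definition connected_components (m : nat) (t : 'S_m) : {set {set 'I_m}} :=
  odflt set0 [pick P | finest_invariant_interval_partition t P].

Definition nb_right_components (m : nat) (s : 'S_m) : nat :=
  #|connected_components (perm_rev s)|.

(* Lattice words are sequences of booleans: true is U = (1, 1) and false is
   D = (1, -1). *)

Definition height (w : seq bool) : int :=
  (\sum_(s <- w) (if s then 1 else -1))%R.

Definition dyck_prefix (w : seq bool) : bool :=
  all (fun i => (0 <= height (take i w))%R) (iota 0 (size w).+1).

Definition dyck_path (w : seq bool) : bool :=
  dyck_prefix w && (height w == 0%R).

Definition ret (w : seq bool) : nat :=
  count (fun i => ~~ nth true w i && (height (take i.+1 w) == 0%R))
        (iota 0 (size w)).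

Definition word_on (S : seq nat) (t : seq nat) : seq nat :=
  [seq nth 0 S i.-1 | i <- t].

Definition setminus (N : nat) (X : seq nat) : seq nat :=
  [seq x <- iota 1 N | x \notin X].

(* One unfolding of the recursion defining Psi, on a nonempty word
   w = U^j D^k w' of length 2n.  In each case the word of sigma is listed from
   left to right. *)
Definition Psi_step (Psi : seq bool -> seq nat) (w : seq bool) : seq nat :=
  let n := (size w)./2 in
  let j := index false w in
  let k := index true (drop j w) in
  let w' := drop (j + k) w in
  if j <= n then
    (2 * n + 1 - j)
      :: [seq 2 * n + 2 - i | i <- iota 2 (k - 1)]
      ++ word_on
           (setminus (2 * n)
              (iota 1 (k - 1) ++ [:: j; 2 * n + 1 - j]
                 ++ iota (2 * n - k + 2) (k - 1)))
           (Psi (nseq (j - k) true ++ w'))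
      ++ rev (iota 1 (k - 1)) ++ [:: j]
  else if j == n + 1 then
    n :: [seq 2 * n + 2 - i | i <- iota 2 k]
      ++ word_on
           (setminus (2 * n)
              (iota 1 k ++ [:: n; n + 1] ++ iota (2 * n - k + 1) k))
           (Psi (nseq (n - k - 1) true ++ w'))
      ++ rev (iota 1 k) ++ [:: n + 1]
  else
    n :: word_on (setminus (2 * n) [:: n; n + 1])
           (Psi (nseq (j - 2) true ++ nseq k false ++ w'))
      ++ [:: n + 1].

Fixpoint Psi_fuel (f : nat) (w : seq bool) : seq nat :=
  if f is f'.+1 then
    if w is [::] then [::] else Psi_step (Psi_fuel f') w
  else [::].

Definition Psi (w : seq bool) : seq nat := Psi_fuel (size w) w.

Lemma Psi_step_ext (F G : seq bool -> seq nat) (v : seq bool) :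
  0 < size v -> (forall u, size u < size v -> F u = G u) ->
  Psi_step F v = Psi_step G v.
Proof.
move=> v_gt0 E; rewrite /Psi_step.
set j := index false v; set k := index true (drop j v).
have hj : j <= size v by exact: index_size.
have hk : k <= size v - j by rewrite -size_drop; exact: index_size.
have k0 : k = 0 -> j = size v.
  move=> hk0; apply/eqP; rewrite eqn_leq hj leqNgt; apply/negP => hlt.
  have : nth true v j = false by apply: nth_index; rewrite -index_mem.
  move: hk0; rewrite /k (drop_nth true hlt) /=.
  by case: (nth true v j).
case: ifP => h1; [|case: ifP => h2].
- by rewrite E // size_cat size_nseq size_drop; lia.
- by rewrite E // size_cat size_nseq size_drop; lia.
- by rewrite E // !size_cat !size_nseq size_drop; lia.
Qed.

Lemma Psi_fuel_stable (f g : nat) (w : seq bool) :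
  size w <= f -> size w <= g -> Psi_fuel f w = Psi_fuel g w.
Proof.
elim: f g w => [|f IH] [|g] [|b w] //= hf hg.
by apply: Psi_step_ext => //= u hu; apply: IH; lia.
Qed.

(* The fuel size w suffices, so Psi satisfies the intended recursion. *)
Lemma PsiE (w : seq bool) :
  Psi w = if w is [::] then [::] else Psi_step Psi w.
Proof.
case: w => [|b w] //; rewrite /Psi /=.
by apply: Psi_step_ext => //= u hu; apply: Psi_fuel_stable; lia.
Qed.

(* Phi s is the Dyck prefix of length 2n sent to s by Psi; the default value of
   the choice is never used on C123 n, onto which Psi is a bijection. *)
Definition Phi (n : nat) (s : 'S_(2 * n)) : (2 * n).-tuple bool :=
  odflt (nseq_tuple (2 * n) true)
    [pick w : (2 * n).-tuple bool | dyck_prefix w && (Psi w == oneline s)].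

(* Main.v *)
Require Import Defs.
From mathcomp Require Import all_boot all_order all_fingroup all_algebra.
From mathcomp Require Import zify.

(** The right components of [s] are counted by its cuts: the [c < 2n] such that
    the last [c] letters are exactly [1, ..., c].  All three cases of the
    recursion for Psi have the same shape: an outer layer of [k] letters on each
    side, whose end letters are [2n+1-j] and [j] (or [n] and [n+1]), around a
    smaller word.  A cut [0 < c < 2n] lies between the last and the first
    letter.  Hence in cases (b) and (c) only [c = 0] remains, matching
    [ret = 0].  In case (a) the cuts strictly between [0] and [2n] are those of
    the inner word shifted by [k], joined by [k] and [2n - k] exactly when
    [j = k], which is when the first run of down steps returns to the axis.

    That every [s] in [C123 n] is a value of Psi follows by peeling the same
    layer, with [k] maximal: a larger letter right after the layer would form a
    pattern 123 with the first letter and the largest letter not yet read, so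
    the inner word starts low enough for its preimage to begin with more than
    [j - k] up steps. *)

(** * Lattice words from a given height *)

(** The starting height is a parameter so that inductions can cross a letter. The predecessor in
    [ret_from] and [end_from] is truncated at 0; they agree with [ret] and [height] on words
    accepted by [dyck_from]. *)
Fixpoint dyck_from (h : nat) (w : seq bool) : bool :=
  if w is b :: w' then
    if b then dyck_from h.+1 w' else (0 < h) && dyck_from h.-1 w'
  else true.

Fixpoint ret_from (h : nat) (w : seq bool) : nat :=
  if w is b :: w' then
    if b then ret_from h.+1 w' else (h == 1) + ret_from h.-1 w'
  else 0.

Fixpoint end_from (h : nat) (w : seq bool) : nat :=
  if w is b :: w' then end_from (if b then h.+1 else h.-1) w' else h.

Lemma height_nil : height [::] = 0%R.
Proof. by rewrite /height big_nil. Qed.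

Lemma height_cons b w :
  height (b :: w) = ((if b then 1 else -1) + height w)%R.
Proof. by rewrite /height big_cons. Qed.

Lemma all_iota0S (P : pred nat) m :
  all P (iota 0 m.+1) = P 0 && all (preim S P) (iota 0 m).
Proof. by rewrite /= (iotaDl 1 0) all_map. Qed.

Lemma count_iota0S (P : pred nat) m :
  count P (iota 0 m.+1) = P 0 + count (preim S P) (iota 0 m).
Proof. by rewrite /= (iotaDl 1 0) count_map. Qed.

Lemma dyck_prefix_from w : dyck_prefix w = dyck_from 0 w.
Proof.
rewrite /dyck_prefix.
have E h : all (fun i => (0 <= h%:Z + height (take i w))%R)
             (iota 0 (size w).+1) = dyck_from h w.
  elim: w h => [|b w IH] h; first by rewrite /= height_nil; lia.
  rewrite all_iota0S take0 height_nil (_ : (0 <= _)%R = true) ?andTb; last by lia.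
  case: b; rewrite [dyck_from _ _]/= -IH.
    by apply: eq_all => i /=; rewrite height_cons; lia.
  case: h => [|h].
    by rewrite all_iota0S /= take0 height_cons height_nil; lia.
  by apply: eq_all => i /=; rewrite height_cons; lia.
by rewrite -(E 0); apply: eq_all => i /=; lia.
Qed.

Lemma ret_ret_from w : dyck_prefix w -> ret w = ret_from 0 w.
Proof.
rewrite dyck_prefix_from /ret.
have E h : dyck_from h w ->
    count (fun i => ~~ nth true w i && (h%:Z + height (take i.+1 w) == 0)%R)
      (iota 0 (size w)) = ret_from h w.
  elim: w h => [|b w IH] h //.
  rewrite count_iota0S /= take0 height_cons height_nil.
  case: b => /= [D|/andP[h0 D]].
  - rewrite add0n -(IH _ D); apply: eq_count => i /=.
    by rewrite height_cons; congr (_ && _); lia.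
  - rewrite -(IH _ D); congr (nat_of_bool _ + _); first by lia.
    apply: eq_count => i /=.
    by rewrite height_cons; congr (_ && _); lia.
by move=> D; rewrite -(E 0 D); apply: eq_count => i /=; congr (_ && _); lia.
Qed.

Lemma height_end_from w : dyck_prefix w -> height w = end_from 0 w.
Proof.
rewrite dyck_prefix_from.
have E h : dyck_from h w -> (h%:Z + height w)%R = end_from h w.
  elim: w h => [|b w IH] h /=; first by rewrite height_nil; lia.
  by rewrite height_cons; case: b => [D|/andP[h0 D]]; rewrite -(IH _ D); lia.
by move=> D; rewrite -(E 0 D); lia.
Qed.

Lemma dyck_from_ups h j w : dyck_from h (nseq j true ++ w) = dyck_from (h + j) w.
Proof. by elim: j h => [|j IH] h /=; rewrite ?addn0 // IH addSnnS. Qed.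

Lemma dyck_from_downs h k w :
  dyck_from h (nseq k false ++ w) = (k <= h) && dyck_from (h - k) w.
Proof.
elim: k h => [|k IH] h /=; first by rewrite subn0.
by rewrite IH; case: h => [|h] //=; rewrite subSS.
Qed.

Lemma ret_from_ups h j w : ret_from h (nseq j true ++ w) = ret_from (h + j) w.
Proof. by elim: j h => [|j IH] h /=; rewrite ?addn0 // IH addSnnS. Qed.

Lemma ret_from_downs h k w : k <= h ->
  ret_from h (nseq k false ++ w) = ((0 < k) && (h == k)) + ret_from (h - k) w.
Proof.
elim: k h => [|k IH] h kh /=; first by rewrite subn0.
rewrite IH; last by lia.
have -> : h.-1 - k = h - k.+1 by lia.
lia.
Qed.

Lemma end_from_ups h j w : end_from h (nseq j true ++ w) = end_from (h + j) w.
Proof. by elim: j h => [|j IH] h /=; rewrite ?addn0 // IH addSnnS. Qed.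

Lemma end_from_downs h k w :
  end_from h (nseq k false ++ w) = end_from (h - k) w.
Proof.
elim: k h => [|k IH] h /=; first by rewrite subn0.
by rewrite IH; congr end_from; lia.
Qed.

(** Each letter lowers the path by at most one. In cases (b) and (c), where j > n, the word left
    after the first run is shorter than that run: this makes the inner words Dyck prefixes and, with
    the next two lemmas, excludes any return to the axis. *)
Lemma dyck_from_short h w : size w <= h -> dyck_from h w.
Proof. by elim: w h => [|[] w IH] h //= hw; rewrite ?IH; lia. Qed.

Lemma ret_from_short h w : size w < h -> ret_from h w = 0.
Proof. by elim: w h => [|[] w IH] h //= hw; rewrite IH; lia. Qed.

Lemma end_from_short h w : size w < h -> 0 < end_from h w.
Proof. by elim: w h => [|[] w IH] h //= hw; rewrite IH; lia. Qed.

Definition runs (j k : nat) (w : seq bool) : seq bool :=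
  nseq j true ++ nseq k false ++ w.

(** When [k = 0] a nonempty [w] would begin with U and lengthen the first run, so [w] must then be
    empty. *)
Definition runs_maximal (k : nat) (w : seq bool) : bool :=
  ((0 < k) || (w == [::])) && head true w.

Lemma size_runs j k w : size (runs j k w) = j + k + size w.
Proof. by rewrite !size_cat !size_nseq addnA. Qed.

Lemma runs_ex w : exists j k w', w = runs j k w' /\ runs_maximal k w'.
Proof.
elim: w => [|[] w [j [k [w' [-> M]]]]]; first by exists 0, 0, [::].
  by exists j.+1, k, w'.
case: j => [|j]; first by exists 0, k.+1, w'; split=> //; case/andP: M.
by exists 0, 1, (runs j.+1 k w').
Qed.

Lemma dyck_runs_ex w : w != [::] -> dyck_from 0 w ->
  exists j k w', [/\ w = runs j k w', runs_maximal k w', 0 < j, k <= j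
                    & dyck_from (j - k) w'].
Proof.
have [j [k [w' [-> M]]]] := runs_ex w.
rewrite dyck_from_ups dyck_from_downs add0n => nz /andP[kj D].
exists j, k, w'; split=> //.
case: j nz kj D => // nz; rewrite leqn0 => /eqP k0; move: nz M.
by rewrite k0 /runs_maximal /= => /negPf ->.
Qed.

Lemma index_false_runs j k w : runs_maximal k w -> index false (runs j k w) = j.
Proof.
case/andP=> M _; elim: j => [|j IH] /=; last by congr _.+1.
by case: k M => [|k] //= /eqP ->.
Qed.

Lemma drop_ups_runs j k w : drop j (runs j k w) = nseq k false ++ w.
Proof. by rewrite drop_size_cat ?size_nseq. Qed.

Lemma index_true_downs k w : head true w -> index true (nseq k false ++ w) = k.
Proof. by move=> hw; elim: k => [|k /= -> //]; case: w hw => [|[]]. Qed.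

Lemma drop_runs j k w : drop (j + k) (runs j k w) = w.
Proof.
by rewrite /runs catA drop_size_cat // size_cat !size_nseq.
Qed.

Lemma Psi_runs n j k w : runs_maximal k w -> 0 < j -> j + k + size w = 2 * n ->
  Psi (runs j k w) =
  if j <= n then
    (2 * n + 1 - j)
      :: [seq 2 * n + 2 - i | i <- iota 2 (k - 1)]
      ++ word_on
           (setminus (2 * n)
              (iota 1 (k - 1) ++ [:: j; 2 * n + 1 - j]
                 ++ iota (2 * n - k + 2) (k - 1)))
           (Psi (nseq (j - k) true ++ w))
      ++ rev (iota 1 (k - 1)) ++ [:: j]
  else if j == n + 1 then
    n :: [seq 2 * n + 2 - i | i <- iota 2 k]
      ++ word_on
           (setminus (2 * n)
              (iota 1 k ++ [:: n; n + 1] ++ iota (2 * n - k + 1) k))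
           (Psi (nseq (n - k - 1) true ++ w))
      ++ rev (iota 1 k) ++ [:: n + 1]
  else
    n :: word_on (setminus (2 * n) [:: n; n + 1])
           (Psi (runs (j - 2) k w))
      ++ [:: n + 1].
Proof.
move=> M j0 sz; rewrite PsiE.
have -> (T : Type) (A B : T) :
    match runs j k w with [::] => A | _ => B end = B by case: j j0 {sz}.
have hn : (size (runs j k w))./2 = n by rewrite size_runs; lia.
rewrite /Psi_step hn index_false_runs // drop_ups_runs.
by rewrite index_true_downs ?drop_runs //; case/andP: M.
Qed.

(** * The recursive shape of Psi *)

(* [skip n j k] lists increasingly the values left over once [1 .. k-1], [j]
   and their complements have been removed from [1 .. 2n]; indices start at 0. *)
Definition skip (n j k r : nat) : nat :=
  r + k + (j - k <= r) + (2 * n - k - j <= r).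

(** Both lists are strictly increasing, so comparing their elements suffices. [X] is given by
    membership because the cases of the recursion list the removed values differently. *)
Lemma setminus_skip n j k X : 0 < k -> k <= j -> j <= n ->
  (forall x, x \in iota 1 (2 * n) -> (x \in X) =
     [|| x < k, x == j, x == 2 * n + 1 - j | 2 * n + 1 - k < x]) ->
  setminus (2 * n) X = mkseq (skip n j k) (2 * n - 2 * k).
Proof.
move=> k0 kj jn HX; apply: (@irr_sorted_eq _ ltn).
- exact: ltn_trans.
- exact: ltnn.
- by apply: sorted_filter; [exact: ltn_trans | exact: iota_ltn_sorted].
- rewrite /mkseq; apply: (homo_sorted (e := ltn)); last exact: iota_ltn_sorted.
  by move=> x y; rewrite /skip; lia.
move=> x; rewrite mem_filter.
apply/andP/mapP => [[xX xi]|[r]].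
  move: xX; rewrite HX // => xX; move: xi; rewrite mem_iota => xi.
  (* The rank of [x], counted from 0, among the values left. *)
  exists (x - k - (j < x) - (2 * n + 1 - j < x)); first by rewrite mem_iota; lia.
  by rewrite /skip; lia.
rewrite mem_iota => hr ->.
have xi : skip n j k r \in iota 1 (2 * n) by rewrite mem_iota /skip; lia.
by rewrite HX //; split=> //; rewrite /skip; lia.
Qed.

(* The common shape of the three cases of the recursion: case (a) has
   [f = 2n+1-j]; cases (b) and (c) have [f = j = n], and there [k] is one more
   than in the text, respectively 1. *)
Definition nest (n j k f : nat) (t : seq nat) : seq nat :=
  mkseq (fun p =>
    if p == 0 then f
    else if p < k then 2 * n + 1 - p
    else if p < 2 * n - k then skip n j k (nth 0 t (p - k)).-1
    else if p < 2 * n - 1 then 2 * n - 1 - p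
    else 2 * n + 1 - f) (2 * n).

Definition in_range (m : nat) (t : seq nat) : bool :=
  (size t == m) && all (fun x => 0 < x <= m) t.

Lemma in_range_nth m t p : in_range m t -> p < m -> 0 < nth 0 t p <= m.
Proof.
case/andP=> /eqP <- /allP H pm.
by apply: H; exact: mem_nth.
Qed.

Lemma in_range_mkseq m a :
  (forall p, p < m -> 0 < a p <= m) -> in_range m (mkseq a m).
Proof.
move=> H; rewrite /in_range size_mkseq eqxx.
apply/allP => x /mapP[p]; rewrite mem_iota => hp ->; exact: H.
Qed.

Lemma in_range_nest n j k f t :
  0 < k -> k <= j -> j <= n -> 0 < f <= 2 * n ->
  in_range (2 * n - 2 * k) t -> in_range (2 * n) (nest n j k f t).
Proof.
move=> k0 kj jn fn T; apply: in_range_mkseq => p hp.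
have := @in_range_nth _ _ (p - k) T; rewrite /skip.
by do 4?[case: ifP => ?]; lia.
Qed.

Lemma nestE n j k f t S :
  0 < k -> k <= j -> j <= n ->
  in_range (2 * n - 2 * k) t -> S = mkseq (skip n j k) (2 * n - 2 * k) ->
  f :: [seq 2 * n + 2 - i | i <- iota 2 (k - 1)] ++ word_on S t
    ++ rev (iota 1 (k - 1)) ++ [:: 2 * n + 1 - f] = nest n j k f t.
Proof.
move=> k0 kj jn T ->.
have /andP[/eqP szt _] := T.
have sz : size (f :: [seq 2 * n + 2 - i | i <- iota 2 (k - 1)]
    ++ word_on (mkseq (skip n j k) (2 * n - 2 * k)) t
    ++ rev (iota 1 (k - 1)) ++ [:: 2 * n + 1 - f]) = 2 * n.
  rewrite /= !size_cat !size_map size_rev !size_iota szt /=; lia.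
apply: (@eq_from_nth _ 0); first by rewrite sz size_mkseq.
move=> p; rewrite sz => hp.
rewrite nth_mkseq // -cat1s !nth_cat !size_map size_rev !size_iota szt /=.
case: eqP => [-> //|p0]; rewrite ltnS leqNgt lt0n (introN eqP p0) /=.
case: ifP => h1.
  rewrite (_ : p < k); last by lia.
  rewrite (nth_map 0) ?size_iota // nth_iota //; lia.
rewrite (_ : (p < k) = false); last by lia.
case: ifP => h2.
  rewrite (_ : p < _ - _); last by lia.
  rewrite (nth_map 0) ?szt //.
  have := @in_range_nth _ _ (p - k) T.
  rewrite (_ : p - 1 - (k - 1) = p - k); last by lia.
  by move=> H; rewrite nth_mkseq //; lia.
rewrite (_ : (p < _ - k) = false); last by lia.
case: ifP => h3.
  rewrite (_ : p < _ - 1); last by lia.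
  by rewrite nth_rev ?size_iota // nth_iota; lia.
rewrite (_ : (p < 2 * n - 1) = false); last by lia.
by rewrite (_ : _ - (k - 1) = 0) //; lia.
Qed.

Lemma Psi_le n j k w :
  runs_maximal k w -> 0 < k -> k <= j -> j <= n -> j + k + size w = 2 * n ->
  in_range (2 * n - 2 * k) (Psi (nseq (j - k) true ++ w)) ->
  Psi (runs j k w) =
  nest n j k (2 * n + 1 - j) (Psi (nseq (j - k) true ++ w)).
Proof.
move=> M k0 kj jn sz T; rewrite (@Psi_runs n) ?jn //; last by lia.
rewrite -(@nestE _ _ _ _ _ (setminus (2 * n)
              (iota 1 (k - 1) ++ [:: j; 2 * n + 1 - j]
                 ++ iota (2 * n - k + 2) (k - 1)))) //.
  by do 5!congr (_ ++ _) || congr (_ :: _); lia.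
apply: setminus_skip => // x; rewrite mem_iota => hx.
by rewrite !mem_cat !inE !mem_iota; lia.
Qed.

Lemma Psi_eq n k w :
  runs_maximal k w -> n.+1 + k + size w = 2 * n ->
  in_range (2 * n - 2 * k.+1) (Psi (nseq (n - k.+1) true ++ w)) ->
  Psi (runs n.+1 k w) = nest n n k.+1 n (Psi (nseq (n - k.+1) true ++ w)).
Proof.
move=> M sz T; rewrite (@Psi_runs n) // ltnn addn1 eqxx.
have -> : n - k - 1 = n - k.+1 by lia.
rewrite -(@nestE _ _ _ _ _ (setminus (2 * n)
              (iota 1 k ++ [:: n; n.+1] ++ iota (2 * n - k + 1) k))) //; try lia.
  rewrite subn1; do 5!congr (_ ++ _) || congr (_ :: _); lia.
apply: setminus_skip => //; try lia; move=> x; rewrite mem_iota => hx.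
by rewrite !mem_cat !inE !mem_iota; lia.
Qed.

Lemma Psi_ge n j k w :
  runs_maximal k w -> n.+1 < j -> j + k + size w = 2 * n ->
  in_range (2 * n - 2) (Psi (runs (j - 2) k w)) ->
  Psi (runs j k w) = nest n n 1 n (Psi (runs (j - 2) k w)).
Proof.
move=> M nj sz T; rewrite (@Psi_runs n) //; last by lia.
rewrite (_ : j <= n = false); last by lia.
rewrite (_ : j == n + 1 = false); last by lia.
rewrite -(@nestE _ _ _ _ _ (setminus (2 * n) [:: n; n + 1])) //; try lia.
  rewrite subnn /=; have -> : 2 * n + 1 - n = n + 1 by lia.
  by [].
apply: setminus_skip => //; try lia; move=> x; rewrite mem_iota => hx.
by rewrite !inE; lia.
Qed.

(** The last hypothesis is an induction hypothesis in [Psi_in_range], which discharges it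
    afterwards. For [j > n] the inner word stays anonymous: the end letters alone exclude proper
    cuts. *)
Lemma Psi_nest n w : 0 < n -> dyck_from 0 w -> size w = 2 * n ->
    (forall m u, m < n -> dyck_from 0 u -> size u = 2 * m ->
       in_range (2 * m) (Psi u)) ->
  exists j k w', [/\ w = runs j k w', runs_maximal k w', 0 < j & k <= j] /\
    dyck_from (j - k) w' /\
    if j <= n then
      [/\ 0 < k, in_range (2 * n - 2 * k) (Psi (nseq (j - k) true ++ w')) &
       Psi w = nest n j k (2 * n + 1 - j) (Psi (nseq (j - k) true ++ w'))]
    else exists l t, [/\ 0 < l, l <= n, in_range (2 * n - 2 * l) t &
       Psi w = nest n n l n t].
Proof.
move=> n0 D sz H.
have wN : w != [::] by apply/eqP => w0; move: sz; rewrite w0 /=; lia.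
have [j [k [w' [wE M j0 kj D']]]] := dyck_runs_ex _ wN D.
move: sz; rewrite wE size_runs => sz.
(* With [m = n - k] the length reads [2 * n - 2 * k], the form used with [nest]. *)
have H' m u : m < n -> dyck_from 0 u -> size u = 2 * n - 2 * (n - m) ->
    in_range (2 * n - 2 * (n - m)) (Psi u).
  move=> mn Du; rewrite (_ : _ - _ = 2 * m); last by lia.
  exact: H.
exists j, k, w'; do 2!split=> //; case: ifP => jn.
  (* Without down steps the word would be U^(2n), against [j <= n]. *)
  have k0 : 0 < k by case/andP: M => /orP[//|/eqP w0]; move: sz; rewrite w0 /=; lia.
  have T : in_range (2 * n - 2 * k) (Psi (nseq (j - k) true ++ w')).
    have := H' (n - k) (nseq (j - k) true ++ w'); rewrite subKn; last by lia.
    by apply; rewrite ?dyck_from_ups // ?size_cat ?size_nseq; lia.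
  by split=> //; exact: Psi_le.
have [jE|jN] := eqVneq j n.+1.
  have T : in_range (2 * n - 2 * k.+1) (Psi (nseq (n - k.+1) true ++ w')).
    have := H' (n - k.+1) (nseq (n - k.+1) true ++ w'); rewrite subKn; last by lia.
    apply; rewrite ?dyck_from_ups ?size_cat ?size_nseq; try lia.
    (* Since [j = n + 1], the word [w'] has exactly [n - k - 1] letters, the height it starts
       from. *)
    by apply: dyck_from_short; lia.
  exists k.+1, (Psi (nseq (n - k.+1) true ++ w')); split=> //; first by lia.
  by rewrite jE; apply: Psi_eq => //; lia.
have T : in_range (2 * n - 2 * 1) (Psi (runs (j - 2) k w')).
  have := H' (n - 1) (runs (j - 2) k w'); rewrite subKn; last by lia.
  apply; rewrite ?size_runs; try lia.
  rewrite dyck_from_ups; apply: dyck_from_short.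
  by rewrite size_cat size_nseq; lia.
exists 1, (Psi (runs (j - 2) k w')); split=> //.
by apply: Psi_ge => //; lia.
Qed.

Lemma Psi_in_range n w :
  dyck_from 0 w -> size w = 2 * n -> in_range (2 * n) (Psi w).
Proof.
elim/ltn_ind: n w => n IH w D sz.
have [n0|n0] := posnP n; first by rewrite n0 (size0nil (s := w)) // sz n0.
have [j [k [w' [[_ _ j0 kj] [_]]]]] :=
  Psi_nest _ _ n0 D sz (fun m u lt => IH m lt u).
case: ifP => jn.
  by case=> k0 T ->; apply: in_range_nest => //; lia.
by case=> l [t [l0 ln T ->]]; apply: in_range_nest => //; lia.
Qed.

Lemma nth_nest_first n j k f t : 0 < n -> nth 0 (nest n j k f t) 0 = f.
Proof. by move=> n0; rewrite nth_mkseq //; lia. Qed.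

Lemma nth_nest_last n j k f t :
  0 < k -> k <= n -> nth 0 (nest n j k f t) (2 * n - 1) = 2 * n + 1 - f.
Proof.
move=> k0 kn; rewrite nth_mkseq; last by lia.
by do 4?[case: ifP => ?]; lia.
Qed.

(** Links the first run of up steps to the end letters. It bounds the cuts of an inner word, and in
    [Psi_surj] it recovers the first run of a preimage from its first letter. *)
Lemma Psi_ends n w : 0 < n -> dyck_from 0 w -> size w = 2 * n ->
  let f := if index false w <= n then 2 * n + 1 - index false w else n in
  nth 0 (Psi w) 0 = f /\ nth 0 (Psi w) (2 * n - 1) = 2 * n + 1 - f.
Proof.
move=> n0 D sz.
have [j [k [w' [[-> M j0 kj] [_]]]]] :=
  Psi_nest _ _ n0 D sz (fun m u _ => Psi_in_range m u).
rewrite index_false_runs //; case: ifP => jn.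
  case=> k0 T ->; rewrite nth_nest_first // nth_nest_last //; lia.
by case=> l [t [l0 ln T ->]]; rewrite nth_nest_first // nth_nest_last.
Qed.

(** * Cuts *)

Definition cut (N : nat) (s : seq nat) (c : nat) : bool :=
  all (fun p => (p + c < N) == (c < nth 0 s p)) (iota 0 N).

Lemma cutP N s c :
  reflect (forall p, p < N -> (p + c < N) = (c < nth 0 s p)) (cut N s c).
Proof.
apply: (iffP allP) => H p.
  move=> pN; have pI : p \in iota 0 N by rewrite mem_iota.
  exact: (eqP (H p pI)).
by rewrite mem_iota add0n => hp; apply/eqP; exact: H.
Qed.

Lemma cut_ends N s c : cut N s c -> 0 < c < N ->
  nth 0 s (N - 1) <= c < nth 0 s 0.
Proof. by move=> /cutP H cN; have := H 0; have := H (N - 1); lia. Qed.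

Lemma cut0 N t : in_range N t -> cut N t 0.
Proof. by move=> T; apply/cutP => p pN; have := in_range_nth _ _ _ T pN; lia. Qed.

Lemma cut_full N t : in_range N t -> cut N t N.
Proof. by move=> T; apply/cutP => p pN; have := in_range_nth _ _ _ T pN; lia. Qed.

(** For [k + c] from [j] to [2 * n - j], the removed values up to [k + c] are exactly the [k] values
    [1 .. k-1] and [j], which stand at the last [k] positions. So the outer layer satisfies the cut
    condition, and inner values up to [c] become values up to [k + c]. *)
Lemma cut_nest n j k t c :
  0 < k -> k <= j -> j <= n -> in_range (2 * n - 2 * k) t ->
  j - k <= c -> c <= 2 * n - k - j ->
  cut (2 * n) (nest n j k (2 * n + 1 - j) t) (k + c) = cut (2 * n - 2 * k) t c.
Proof.
move=> k0 kj jn T c1 c2; apply/cutP/cutP => H p hp.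
  have := H (p + k); rewrite nth_mkseq; last by lia.
  have := in_range_nth _ _ p T; rewrite addnK /skip.
  by do 4?[case: ifP => ?]; lia.
rewrite nth_mkseq //; have := H (p - k).
have := in_range_nth _ _ (p - k) T; rewrite /skip.
by do 4?[case: ifP => ?]; lia.
Qed.

Definition nb_cuts (N : nat) (s : seq nat) : nat := count (cut N s) (iota 0 N).

Lemma nb_cuts_proper N s : in_range N s -> 0 < N ->
  nb_cuts N s = (count (cut N s) (iota 1 N.-1)).+1.
Proof. by case: N => // N T _; rewrite /nb_cuts /= cut0. Qed.

Lemma count_iota_sub (P : pred nat) a l b m : a <= b -> b + m <= a + l ->
  (forall c, a <= c < a + l -> P c -> b <= c < b + m) ->
  count P (iota a l) = count P (iota b m).
Proof.
move=> ab bm H.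
have -> : l = (b - a) + (m + (a + l - (b + m))) by lia.
rewrite !iotaD !count_cat subnKC //.
have zero u v : (forall c, u <= c < u + v -> ~~ P c) -> count P (iota u v) = 0.
  move=> Z; apply/eqP; rewrite -leqn0 leqNgt -has_count.
  by apply/hasPn => c; rewrite mem_iota; exact: Z.
rewrite (zero a) ?(zero (b + m)) ?addn0 // => c hc; apply/negP => /H; lia.
Qed.

Lemma index_false_ups j w : j <= index false (nseq j true ++ w).
Proof. by elim: j. Qed.

Lemma nb_cuts_Psi n w : 0 < n -> dyck_from 0 w -> size w = 2 * n ->
  nb_cuts (2 * n) (Psi w) = 2 * ret_from 0 w + (0 < end_from 0 w).
Proof.
elim/ltn_ind: n w => n IH w n0 D sz.
have R := Psi_in_range _ _ D sz.
rewrite nb_cuts_proper //; last by lia.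
have [j [k [w' [[wE M j0 kj] [D']]]]] :=
  Psi_nest _ _ n0 D sz (fun m u _ => Psi_in_range m u).
have szr : j + k + size w' = 2 * n by rewrite -sz wE size_runs.
have -> : ret_from 0 w = ((0 < k) && (j == k)) + ret_from (j - k) w'.
  by rewrite wE ret_from_ups ret_from_downs.
have -> : end_from 0 w = end_from (j - k) w'.
  by rewrite wE end_from_ups end_from_downs.
case: ifP => [jn [k0 T PE]|jn [l [t [l0 ln T PE]]]]; last first.
  rewrite ret_from_short; last by lia.
  rewrite end_from_short; last by lia.
  rewrite (eq_in_count (a2 := pred0)) ?count_pred0; first by lia.
  move=> c; rewrite mem_iota => hc; apply/negP => /cut_ends.
  by rewrite PE nth_nest_first // nth_nest_last //; lia.
(* By the end letters [2 * n + 1 - j] and [j], a proper cut lies from [j] to [2 * n - j]. *)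
rewrite (@count_iota_sub _ 1 (2 * n).-1 j (2 * n - 2 * j).+1); first last.
- move=> c hc /cut_ends.
  by rewrite PE nth_nest_first // nth_nest_last //; lia.
- lia.
- lia.
rewrite -{1}(subnKC kj) iotaDl count_map PE.
rewrite (eq_in_count (a2 := cut (2 * n - 2 * k) (Psi (nseq (j - k) true ++ w'))));
  last first.
  by move=> c; rewrite mem_iota /= => hc; rewrite cut_nest //; lia.
have D1 : dyck_from 0 (nseq (j - k) true ++ w') by rewrite dyck_from_ups.
have sz1 : size (nseq (j - k) true ++ w') = 2 * (n - k).
  by rewrite size_cat size_nseq; lia.
move: T; rewrite -(mulnBr 2 n k); set t := Psi _ => T.
have IHt : 0 < n - k -> nb_cuts (2 * (n - k)) t =
    2 * ret_from (j - k) w' + (0 < end_from (j - k) w').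
  move=> nk; rewrite IH //; last by lia.
  by rewrite ret_from_ups end_from_ups.
(* If [j = k] the shifted range runs from 0 to [2 * (n - k)] inclusive: it holds all inner cuts
   counted by [nb_cuts] and the full one. With the outer cut 0 this adds two, matching the one new
   return. *)
have [kjE|kjN] := eqVneq j k.
  have [nk|nk] := posnP (n - k).
    have -> : 2 * n - 2 * j = 0 by lia.
    have -> : w' = [::] by apply: size0nil; lia.
    by rewrite kjE subnn k0 /= (cut0 _ _ T).
  move: (IHt nk); rewrite kjE subnn -mulnBr -/t -[(2 * _).+1]addn1.
  by rewrite iotaD count_cat /= add0n cut_full // -/(nb_cuts _ _); lia.
(* Now [k < j]: both trivial inner cuts fall outside the range, and the outer cut 0 replaces the
   inner cut 0. The proper inner cuts all lie in the range, because the inner word begins with at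
   least [j - k] up steps. *)
rewrite andbF add0n -IHt; last by lia.
rewrite nb_cuts_proper //; last by lia.
congr _.+1; apply/esym.
apply: count_iota_sub; try lia.
move=> c hc /cut_ends.
have := index_false_ups (j - k) w'.
have nk : 0 < n - k by lia.
have [-> ->] := Psi_ends _ _ nk D1 sz1; case: ifP; lia.
Qed.

(** * Surjectivity of Psi *)

(* Permutations of [1 .. 2n] as functions of a position counted from 0; values
   outside [0 .. 2n-1] are irrelevant. *)
Definition centro123 (n : nat) (a : nat -> nat) : Prop :=
  [/\ forall p, p < 2 * n -> 0 < a p <= 2 * n,
      forall p q, p < 2 * n -> q < 2 * n -> a p = a q -> p = q,
      forall p, p < 2 * n -> a p + a (2 * n - 1 - p) = 2 * n + 1 &
      forall p q r, p < q -> q < r -> r < 2 * n ->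
        a p < a q -> a q < a r -> False].

Lemma value_occurs N (a : nat -> nat) v :
  (forall p, p < N -> 0 < a p <= N) ->
  (forall p q, p < N -> q < N -> a p = a q -> p = q) ->
  0 < v <= N -> exists2 p, p < N & a p = v.
Proof.
move=> rng inj vN.
have u : uniq (mkseq a N).
  rewrite map_inj_in_uniq ?iota_uniq // => p q.
  by rewrite !mem_iota !add0n; exact: inj.
have sub : {subset mkseq a N <= iota 1 N}.
  move=> x /mapP[p]; rewrite !mem_iota add0n => /rng; lia.
have [|_ E] := uniq_min_size u sub; first by rewrite size_mkseq size_iota.
have : v \in mkseq a N by rewrite E mem_iota; lia.
by case/mapP=> p; rewrite mem_iota => hp ->; exists p.
Qed.

(** The rank of [v], counted from 0, among the values left; it inverts [skip] on the values
    satisfying [kept]. *)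
Definition unskip (n j k v : nat) : nat :=
  v - k - (j < v) - (2 * n + 1 - j < v).

Definition kept (n j k v : nat) : bool :=
  [&& k <= v, v <= 2 * n + 1 - k, v != j & v != 2 * n + 1 - j].

Lemma unskip_bound n j k v : k <= j -> j <= n -> kept n j k v ->
  unskip n j k v < 2 * (n - k).
Proof.
rewrite /unskip => kj jn /and4P[h1 h2 /eqP h3 /eqP h4].
by case: (ltnP j v) => ?; case: (ltnP (_ - j) v) => ?; lia.
Qed.

Lemma unskipK n j k v : k <= j -> j <= n -> kept n j k v ->
  skip n j k (unskip n j k v) = v.
Proof.
rewrite /skip /unskip => kj jn /and4P[h1 h2 /eqP h3 /eqP h4].
by case: (ltnP j v) => ?; case: (ltnP (_ - j) v) => ? /=; lia.
Qed.

Lemma unskip_sym n j k u v : k <= j -> j <= n -> kept n j k v ->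
  u + v = 2 * n + 1 ->
  unskip n j k u + unskip n j k v = 2 * (n - k) - 1.
Proof.
rewrite /unskip => kj jn /and4P[h1 h2 /eqP h3 /eqP h4] uv.
have -> : (j < u) = (v < 2 * n + 1 - j) by lia.
have -> : (2 * n + 1 - j < u) = (v < j) by lia.
by case: (ltngtP j v) => ?; case: (ltngtP (_ - j) v) => ? /=; lia.
Qed.

Lemma ltn_unskip n j k u v : k <= j -> j <= n ->
  kept n j k u -> kept n j k v ->
  (unskip n j k u < unskip n j k v) = (u < v).
Proof.
move=> kj jn hu hv.
have lt_skip r q : r < q -> skip n j k r < skip n j k q by rewrite /skip; lia.
rewrite -{2}(unskipK n j k u) // -{2}(unskipK n j k v) //.
case: (ltngtP (unskip n j k u)) => [/lt_skip -> //|/lt_skip h|->].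
  by rewrite ltnNge ltnW.
by rewrite ltnn.
Qed.

(** Meant for the first inner letter: its rank is then small enough, by [Psi_ends], to force the
    preimage of the inner word to begin with more than [j - k] up steps. *)
Lemma unskip_below n j k v : k <= j -> j <= n -> kept n j k v ->
  v < 2 * n + 1 - j -> unskip n j k v < 2 * n - k - j.
Proof.
rewrite /unskip => kj jn /and4P[h1 h2 /eqP h3 /eqP h4] hv.
by case: (ltnP j v) => ?; case: (ltnP (_ - j) v) => ?; lia.
Qed.

Section Peel.

Variables (n j k : nat) (a : nat -> nat).
Hypotheses (aC : centro123 n a) (k0 : 0 < k) (kj : k <= j) (jn : j <= n).
(** The second alternative serves [a 0 = j = n], which is how cases (b) and (c) appear. *)
Hypothesis first_val : a 0 = 2 * n + 1 - j \/ a 0 = j.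
Hypothesis run : forall p, 0 < p < k -> a p = 2 * n + 1 - p.

Let b (p : nat) : nat := (unskip n j k (a (p + k))).+1.

Lemma peel_middle p : k <= p < 2 * n - k ->
  kept n j k (a p).
Proof.
move=> hp; case: aC => rng inj sym _.
have top q : k <= q < 2 * n - k -> a q <= 2 * n + 1 - k.
  move=> hq; rewrite leqNgt; apply/negP => lt.
  have q2n : q < 2 * n by lia.
  have /andP[q1 q2] := rng q q2n.
  (* A value above [2 * n + 1 - k] is already placed by [run], at one of the positions
     [1 .. k-1]. *)
  have E : a (2 * n + 1 - a q) = a q by rewrite run; lia.
  have := inj _ _ _ q2n E; lia.
have p2n : p < 2 * n by lia.
have n0 : 0 < 2 * n by lia.
have ne q : q < 2 * n -> q != p -> a p != a q.
  by move=> hq /eqP qp; apply/eqP => E; apply: qp; exact: inj.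
have ne0 : a p != a 0 by apply: ne; lia.
have ne1 : a p != a (2 * n - 1) by apply: ne; lia.
have t0 := top p hp.
have t1 : a (2 * n - 1 - p) <= 2 * n + 1 - k by apply: top; lia.
have s0 := sym p p2n; have := sym 0 n0; rewrite subn0 => s1.
by apply/and4P; clear - t0 t1 ne0 ne1 s0 s1 first_val kj jn; split; lia.
Qed.

Lemma peel_centro123 : centro123 (n - k) b.
Proof.
case: aC => rng inj sym av.
have keep p : p < 2 * (n - k) -> kept n j k (a (p + k)).
  by move=> hp; apply: peel_middle; lia.
have lt p : p < 2 * (n - k) -> p + k < 2 * n by lia.
split; rewrite /b.
- by move=> p hp; rewrite unskip_bound ?keep.
- move=> p q hp hq [E]; apply: (@addIn k); apply: inj; rewrite ?lt //.
  case: (ltngtP (a (p + k)) (a (q + k))) => //;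
    by rewrite -(ltn_unskip n j k) ?keep // E ltnn.
- move=> p hp; have E := sym _ (lt p hp); rewrite addnC in E.
  have -> : 2 * (n - k) - 1 - p + k = 2 * n - 1 - (p + k) by lia.
  by have := unskip_sym _ _ _ _ _ kj jn (keep p hp) E; lia.
- move=> p q r pq qr hr; have hq := ltn_trans qr hr; have hp := ltn_trans pq hq.
  rewrite !ltnS !ltn_unskip ?keep //.
  by apply: av; rewrite ?ltn_add2r ?lt.
Qed.

Lemma peel_nest :
  mkseq a (2 * n) = nest n j k (a 0) (mkseq b (2 * n - 2 * k)).
Proof.
case: aC => rng inj sym av.
apply: (@eq_from_nth _ 0) => [|p]; first by rewrite !size_mkseq.
rewrite size_mkseq => hp; rewrite nth_mkseq // [RHS]nth_mkseq //.
case: eqP => [-> //|p0]; case: ifP => h1; first by apply: run; lia.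
case: ifP => h2.
  rewrite nth_mkseq; last by lia.
  rewrite /b subnK; last by lia.
  by rewrite unskipK // peel_middle // leqNgt h1.
have := sym p hp; case: ifP => h3; first by rewrite (run (2 * n - 1 - p)); lia.
by rewrite (_ : 2 * n - 1 - p = 0); lia.
Qed.

End Peel.

Lemma peel_ex n a : centro123 n a -> 0 < n ->
  exists j k, [/\ 0 < k, k <= j, j <= n &
    [/\ (n < a 0 /\ a 0 = 2 * n + 1 - j) \/ (a 0 = n /\ j = n),
        forall p, 0 < p < k -> a p = 2 * n + 1 - p &
        k < n -> a k < 2 * n + 1 - j]].
Proof.
case=> rng inj sym av n0.
have n20 : 0 < 2 * n by lia.
have r0 := rng 0 n20; have := sym 0 n20; rewrite subn0 => s0.
(* If [a 0 < n], the last letter exceeds [n + 1] by symmetry, and [a 0], [n] and the last letter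
   form a pattern 123. *)
have Fn : n <= a 0.
  rewrite leqNgt; apply/negP => lt.
  have vn : 0 < n <= 2 * n by lia.
  have [p pn pv] := value_occurs _ _ n rng inj vn.
  apply: (av 0 p (2 * n - 1)); rewrite ?pv; try lia.
    by rewrite lt0n; apply/eqP => p0; move: pv; rewrite p0; lia.
  have [p1|] := eqVneq p (2 * n - 1); last by lia.
  by move: pv; rewrite p1; lia.
pose j := if n < a 0 then 2 * n + 1 - a 0 else n.
have F : (n < a 0 /\ a 0 = 2 * n + 1 - j) \/ (a 0 = n /\ j = n).
  by rewrite /j; case: ifP => h; [left | right]; lia.
have jn : 0 < j <= n by clear - F r0 n0; lia.
(* The least such [k] stops the run [2n, 2n-1, ...] where it first fails, or at [j]; this is the
   maximal layer. *)
have ex : exists k, (0 < k) && ((k == j) || (a k != 2 * n + 1 - k)).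
  by exists j; rewrite eqxx andbT; case/andP: jn.
case: (ex_minnP ex) => k /andP[k0 kE] kmin.
have kj : k <= j by apply: kmin; rewrite eqxx andbT; case/andP: jn.
have run p : 0 < p < k -> a p = 2 * n + 1 - p.
  case/andP=> p0 pk; apply/eqP/negPn/negP => ne.
  by have := kmin p; rewrite ne orbT p0 leqNgt pk; move/(_ isT).
exists j, k; split=> //; first by case/andP: jn.
split=> // kn; rewrite ltnNge; apply/negP => ge.
have k2n : k < 2 * n by lia.
have rk := rng k k2n.
have ne q : q < 2 * n -> q != k -> a k != a q.
  by move=> hq /eqP qk; apply/eqP => E; apply: qk; exact: inj.
have ak0 : a k != a 0 by apply: ne => //; rewrite eq_sym -lt0n.
(* The values above 2n+1-k stand at the positions 1 .. k-1. *)
have ak1 : a k <= 2 * n + 1 - k.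
  rewrite leqNgt; apply/negP => lt.
  have := ne (2 * n + 1 - a k); rewrite (run (2 * n + 1 - a k)); last by lia.
  by lia.
have ak2 : a k != 2 * n + 1 - k.
  (* If [k = j], equality would repeat the first letter [2 * n + 1 - j]; in the alternative
     [a 0 = n] one has [j = n], against [k < n]. *)
  by move: kE => /orP[/eqP kjE|//]; rewrite kjE in ge ak0 ak1 *; lia.
have vn : 0 < 2 * n + 1 - k <= 2 * n by lia.
have [p pn pv] := value_occurs _ _ _ rng inj vn.
have kp : k < p.
  rewrite ltnNge leq_eqVlt; apply/negP => /orP[/eqP pk|pk].
    by move: pv ak2; rewrite pk => ->; rewrite eqxx.
  have [p0|p0] := posnP p; first by move: pv; rewrite p0; lia.
  by move: pv; rewrite run ?p0 //; lia.
(* The pattern is [a 0 < a k < 2 * n + 1 - k], the last value standing at [p > k]. *)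
by apply: (av 0 k p) => //; lia.
Qed.

Lemma split_ups i w : i < index false w ->
  exists2 w', w = nseq i true ++ w' & head true w'.
Proof.
elim: i w => [|i IH] [|[] w] //=.
- by exists (true :: w).
- by rewrite ltnS => /IH[w' -> hw']; exists w'.
Qed.

(** By strong induction the peeled word has a preimage [w1]. Removing its first [j - k] up steps
    leaves [w'], and a first run with its down steps is put back according to the case. *)
Lemma Psi_surj n a : centro123 n a ->
  exists w, [/\ size w = 2 * n, dyck_from 0 w & Psi w = mkseq a (2 * n)].
Proof.
elim/ltn_ind: n a => n IH a aC.
have [n0|n0] := posnP n; first by exists [::]; rewrite n0 PsiE.
have [j [k [k0 kj jn [F run ak]]]] := peel_ex _ _ aC n0.
have F' : a 0 = 2 * n + 1 - j \/ a 0 = j by clear - F; lia.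
have bC := peel_centro123 _ _ _ _ aC k0 kj jn F' run.
have aE := peel_nest _ _ _ _ aC k0 kj jn F' run.
have lt : n - k < n by lia.
have [w1 [sz1 D1]] := IH _ lt _ bC; rewrite mulnBr => P1.
have R1 := Psi_in_range _ _ D1 sz1; rewrite mulnBr in R1.
rewrite -P1 in aE.
(* This makes [w'] begin with U unless it is empty, so that the restored run of down steps is
   maximal. *)
have long : k < n -> j - k < index false w1.
  move=> kn; have nk : 0 < n - k by lia.
  have kk : k <= k < 2 * n - k by lia.
  have keep := peel_middle _ _ _ _ aC k0 kj jn F' run _ kk.
  have := unskip_below _ _ _ _ kj jn keep (ak kn).
  have [] := Psi_ends _ _ nk D1 sz1; rewrite P1 nth_mkseq ?add0n; last by lia.
  by case: ifP => h E _; lia.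
have [w' wE hw'] : exists2 w', w1 = nseq (j - k) true ++ w' & head true w'.
  have [/long/split_ups //|nk] := ltnP k n.
  exists [::] => //; have -> : j - k = 0 by lia.
  by apply: size0nil; lia.
have sz' : j - k + size w' = 2 * (n - k) by rewrite -sz1 wE size_cat size_nseq.
case: F => [[nF aF]|[aF jE]].
  exists (runs j k w'); split; first by rewrite size_runs; lia.
    by rewrite dyck_from_ups dyck_from_downs kj /= -[X in dyck_from X]add0n
               -dyck_from_ups -wE.
  rewrite aE aF (Psi_le n) -?wE //; last by lia.
  by rewrite /runs_maximal k0 hw'.
subst j; rewrite aF in aE.
(* When [k = 1] and [n > 1], case (b) would need a word with no down step after the first run yet a
   nonempty [w']. Case (c) applies instead: [w1] begins with at least [n] up steps, and two more are
   added. *)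
have [k1|k1] := boolP ((k == 1) && (1 < n)).
  have [k1E n1] := andP k1; rewrite (eqP k1E) in long R1 aE sz1.
  have w1N : w1 != [::] by apply/eqP => w10; move: sz1; rewrite w10 /=; lia.
  have [j1 [k' [w2 [w1E M j10 kj1 D2]]]] := dyck_runs_ex _ w1N D1.
  have nj1 : n - 1 < j1 by have := long n1; rewrite w1E index_false_runs.
  have sz2 : j1 + k' + size w2 = 2 * n - 2 by rewrite -size_runs -w1E; lia.
  exists (runs j1.+2 k' w2); split; first by rewrite size_runs; lia.
    by rewrite dyck_from_ups; apply: dyck_from_short;
       rewrite size_cat size_nseq; lia.
  have E2 : j1.+2 - 2 = j1 by lia.
  rewrite aE (Psi_ge n) //; first by rewrite E2 -w1E.
  - by lia.
  - by lia.
  - by rewrite E2 -w1E.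
have M : runs_maximal k.-1 w'.
  rewrite /runs_maximal hw' andbT.
  have [k2|k2] := ltnP 1 k; first by apply/orP; left; lia.
  have -> : w' = [::] by apply: size0nil; lia.
  by rewrite orbT.
exists (runs n.+1 k.-1 w'); split; first by rewrite size_runs; lia.
  by rewrite dyck_from_ups; apply: dyck_from_short;
     rewrite size_cat size_nseq; lia.
have kE : k.-1.+1 = k by rewrite prednK.
rewrite aE (Psi_eq n) //; first by rewrite kE -wE.
- by lia.
- by rewrite kE -wE.
Qed.

(** * Components and cuts *)

Fixpoint last_true (P : pred nat) (x : nat) : nat :=
  if x is y.+1 then if P x then x else last_true P y else 0.

Lemma last_true_le P x : last_true P x <= x.
Proof. by elim: x => //= x IH; case: ifP => // _; exact: leqW. Qed.

Lemma last_trueP (P : pred nat) x : P 0 -> P (last_true P x).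
Proof. by move=> P0; elim: x => //= x IH; case: ifP. Qed.

Lemma leq_last_true (P : pred nat) c x : P c -> c <= x -> c <= last_true P x.
Proof.
move=> Pc; elim: x => //= x IH; rewrite leq_eqVlt => /orP[/eqP <-|].
  by rewrite Pc.
by case: ifP => _ cx; [exact: ltnW | exact: IH].
Qed.

Lemma last_true_mono P x y : x <= y -> last_true P x <= last_true P y.
Proof.
elim: y => [|y IH]; first by rewrite leqn0 => /eqP ->.
rewrite leq_eqVlt => /orP[/eqP -> //|xy].
apply: leq_trans (IH xy) _ => /=.
by case: ifP => // _; apply: leqW; exact: last_true_le.
Qed.

Section Components.

Context {m : nat}.
Variable t : 'S_m.
Implicit Types (x y u v : 'I_m) (P Q : {set {set 'I_m}}).

Definition stable_below (c : nat) : bool :=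
  [forall x : 'I_m, (x < c) == (t x < c)].

Lemma stable_belowP c :
  reflect (forall x, (x < c) = (t x < c)) (stable_below c).
Proof. exact: 'forall_eqP. Qed.

Lemma stable_below0 : stable_below 0.
Proof. exact/stable_belowP. Qed.

(** Labels a component by its least element, the last stable bound not above [x]; the default 0 of
    [last_true] is itself stable. *)
Definition block_start x : nat := last_true stable_below x.

Lemma block_start_perm x : block_start (t x) = block_start x.
Proof.
have st u : stable_below (block_start u) by exact: last_trueP stable_below0.
have le u : block_start u <= u by exact: last_true_le.
apply/eqP; rewrite eqn_leq; apply/andP; split; apply: leq_last_true => //.
  by rewrite leqNgt (stable_belowP _ (st _)) -leqNgt.
by rewrite leqNgt -(stable_belowP _ (st _)) -leqNgt.
Qed.

Definition block_partition := preim_partition block_start [set: 'I_m].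

Lemma block_partitionE :
  block_partition =
  [set [set y | block_start x == block_start y] | x : 'I_m].
Proof.
apply/setP => B; apply/imsetP/imsetP => -[x _ ->]; exists x => //;
  by apply/setP => y; rewrite !inE.
Qed.

Lemma block_partition_invariant : invariant_interval_partition t block_partition.
Proof.
apply/andP; split; first exact: preim_partitionP.
apply/forall_inP => B; rewrite block_partitionE => /imsetP[x _ ->].
apply/andP; split.
  apply/forall_inP => u; rewrite inE => /eqP xu.
  apply/forall_inP => v; rewrite inE => /eqP xv.
  apply/forallP => y; apply/implyP => /andP[uy yv]; rewrite inE.
  rewrite eqn_leq; apply/andP.
  by split; [rewrite xu | rewrite xv]; exact: last_true_mono.
rewrite eqEcard card_imset ?leqnn ?andbT; last exact: perm_inj.
by apply/subsetP => _ /imsetP[y yB ->]; move: yB; rewrite !inE block_start_perm.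
Qed.

Section Finest.

Variable Q : {set {set 'I_m}}.
Hypothesis QI : invariant_interval_partition t Q.

Let Qpart : partition Q [set: 'I_m].
Proof. by case/andP: QI. Qed.

Let Qtriv : trivIset Q.
Proof. by case/and3P: Qpart. Qed.

Let in_pblock x : x \in pblock Q x.
Proof. by rewrite mem_pblock (cover_partition Qpart) inE. Qed.

Let pblockQ x : pblock Q x \in Q.
Proof. by rewrite pblock_mem // (cover_partition Qpart) inE. Qed.

Lemma pblock_perm x : t x \in pblock Q x.
Proof.
case/andP: QI => _ /forall_inP/(_ _ (pblockQ x))/andP[_ /eqP <-].
exact: imset_f.
Qed.

Lemma pblock_interval x y z : y \in pblock Q x -> z \in pblock Q x ->
  forall u, y <= u <= z -> u \in pblock Q x.
Proof.
move=> yx zx u yuz.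
case/andP: QI => _ /forall_inP/(_ _ (pblockQ x))/andP[/forall_inP H _].
by move/forall_inP: (H y yx) => /(_ z zx)/forallP/(_ u)/implyP; exact.
Qed.

(** If [w] and [t w] lay on different sides of [v], the interval block containing both would contain
    [u] and [v]. *)
Lemma stable_below_pblock_neq u v :
  v = u.+1 :> nat -> pblock Q u != pblock Q v -> stable_below v.
Proof.
move=> vu ne; apply/stable_belowP => w; apply/idP/idP => lt; rewrite ltnNge;
  apply/negP => ge; case/eqP: ne.
  have H := pblock_interval _ _ _ (in_pblock w) (pblock_perm w).
  rewrite (same_pblock Qtriv (H u _)) ?(same_pblock Qtriv (H v _)) //; lia.
have H := pblock_interval _ _ _ (pblock_perm w) (in_pblock w).
rewrite (same_pblock Qtriv (H u _)) ?(same_pblock Qtriv (H v _)) //; lia.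
Qed.

(** Walking from [x] up to [u], a change of block of [Q] would occur at a stable bound above [x],
    and [block_start] would differ at the two ends. *)
Lemma pblock_block_start x u : x <= u -> block_start x = block_start u ->
  pblock Q x = pblock Q u.
Proof.
case: u => u um; elim: u um => [|u IH] um /=.
  by rewrite leqn0 => /eqP x0 _; congr pblock; apply: val_inj.
rewrite leq_eqVlt => /orP[/eqP xu _|]; first by congr pblock; apply: val_inj.
rewrite ltnS => xu E.
have u'm : u < m by exact: ltnW.
have -> : pblock Q x = pblock Q (Ordinal u'm).
  apply: IH => //; apply/eqP; rewrite eqn_leq last_true_mono //= E.
  by apply: last_true_mono => /=.
apply/eqP; apply: contraT => /stable_below_pblock_neq -/(_ erefl) st.
have := leq_last_true _ _ _ st (leqnn _); rewrite -/(block_start _) -E.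
by move/(leq_trans)/(_ (last_true_le _ _)) => /=; rewrite ltnNge xu.
Qed.

Lemma block_partition_refines : refines block_partition Q.
Proof.
apply/forall_inP => B; rewrite block_partitionE => /imsetP[x _ ->].
apply/existsP; exists (pblock Q x); rewrite pblockQ /=.
apply/subsetP => y; rewrite inE => /eqP E.
have [xy|/ltnW yx] := leqP x y; first by rewrite (pblock_block_start _ _ xy E).
by rewrite -(pblock_block_start _ _ yx (esym E)).
Qed.

End Finest.

Lemma refines_anti P Q : partition P [set: 'I_m] -> partition Q [set: 'I_m] ->
  refines P Q -> refines Q P -> P \subset Q.
Proof.
move=> PP PQ rPQ rQP; apply/subsetP => B BP.
have /existsP[C /andP[CQ BC]] := forall_inP rPQ B BP.
have /existsP[B' /andP[BP' CB']] := forall_inP rQP C CQ.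
have [_ trP nP] := and3P PP.
have [x xB] : exists x, x \in B.
  by apply/set0Pn; apply: contraNneq nP => <-.
have xB' : x \in B' by apply: (subsetP CB'); exact: (subsetP BC).
have EB : B = B' by rewrite -(def_pblock trP BP xB) (def_pblock trP BP' xB').
suff -> : B = C by [].
by apply/eqP; rewrite eqEsubset BC EB CB'.
Qed.

Lemma connected_componentsE : connected_components t = block_partition.
Proof.
have I := block_partition_invariant.
rewrite /connected_components; case: pickP => [P /andP[PI /forallP PF]|] /=.
  have r1 := implyP (PF _) I; have r2 := block_partition_refines _ PI.
  have /andP[p1 _] := PI; have /andP[p2 _] := I.
  by apply/eqP; rewrite eqEsubset !refines_anti.
move/(_ block_partition); rewrite /finest_invariant_interval_partition I /=.
by move/forallP; case=> Q; apply/implyP; exact: block_partition_refines.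
Qed.

(** Components correspond to their least elements, and these are the stable bounds below [m], on
    which [block_start] is the identity. *)
Lemma card_connected_components :
  #|connected_components t| = count stable_below (iota 0 m).
Proof.
rewrite connected_componentsE block_partitionE.
pose fiber x := [set y | block_start x == block_start y].
pose X := [set x : 'I_m | stable_below x].
have startX x : x \in X -> block_start x = x.
  rewrite inE => st; apply/eqP; rewrite eqn_leq last_true_le.
  exact: leq_last_true.
have -> : [set fiber x | x : 'I_m] = fiber @: X.
  apply/setP => B; apply/imsetP/imsetP => -[x xX ->]; last by exists x.
  have lt : block_start x < m by exact: leq_ltn_trans (last_true_le _ _) _.
  have oX : Ordinal lt \in X by rewrite inE; exact: last_trueP stable_below0.
  by exists (Ordinal lt) => //; apply/setP => y; rewrite !inE (startX _ oX).
rewrite card_in_imset => [|x y xX yX /setP/(_ y)]; last first.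
  by rewrite !inE eqxx !startX // => /eqP/val_inj.
rewrite -sum1_card -sum1_count -[iota 0 m](_ : index_iota 0 m = _) ?big_mkord.
  by apply: eq_bigl => x; rewrite inE.
by rewrite /index_iota subn0.
Qed.

End Components.

(** * Transfer from permutations to words *)

Lemma nth_oneline N (s : 'S_N) (i : 'I_N) : nth 0 (oneline s) i = (s i).+1.
Proof. by rewrite (nth_map i) ?size_enum_ord // nth_ord_enum. Qed.

(** Reversal turns the first [c] positions into the last [c], and [oneline] raises values by one, so
    stable bounds of the reverse are cuts of the word. *)
Lemma nb_right_components_cuts N (s : 'S_N) :
  nb_right_components s = nb_cuts N (oneline s).
Proof.
rewrite /nb_right_components card_connected_components.
apply: eq_in_count => c _; apply/stable_belowP/cutP => H.
  move=> p pN; have := H (rev_ord (Ordinal pN)).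
  rewrite permM permE rev_ordK -[p]/(nat_of_ord (Ordinal pN)) nth_oneline /=.
  by lia.
move=> x; have := H (rev_ord x) (ltn_ord _).
by rewrite permM permE nth_oneline /=; have := ltn_ord x; lia.
Qed.

Lemma centro123_oneline n (s : 'S_(2 * n)) : s \in C123 n ->
  centro123 n (nth 0 (oneline s)).
Proof.
rewrite inE => /andP[/forallP cs av].
have E p (pn : p < 2 * n) : nth 0 (oneline s) p = (s (Ordinal pn)).+1.
  by rewrite -nth_oneline.
split.
- by move=> p pn; rewrite E ltn_ord.
- by move=> p q pn qn; rewrite !E => -[] /val_inj/perm_inj[].
- move=> p pn; have := cs (Ordinal pn); rewrite -!nth_oneline /= => /eqP.
  by rewrite (_ : 2 * n - 1 - p = 2 * n - p.+1); lia.
- move=> p q r pq qr rn; have qn := ltn_trans qr rn; have pn := ltn_trans pq qn.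
  rewrite !E !ltnS => h1 h2; case/negP: av.
  apply/existsP; exists (Ordinal pn); apply/existsP; exists (Ordinal qn).
  by apply/existsP; exists (Ordinal rn); rewrite /= pq qr h1 h2.
Qed.

Theorem theorem9 (n : nat) (s : 'S_(2 * n)) (n_gt0 : 0 < n)
    (sC : s \in C123 n) :
  nb_right_components s =
    if dyck_path (Phi s) then 2 * ret (Phi s) else 2 * ret (Phi s) + 1.
Proof.
have [w D P] : exists2 w : (2 * n).-tuple bool,
    dyck_prefix w & Psi w = oneline s.
  have [w [sz D P]] := Psi_surj _ _ (centro123_oneline _ _ sC).
  exists (tcast sz (in_tuple w)); rewrite val_tcast /= ?dyck_prefix_from //.
  have so : size (oneline s) = 2 * n by rewrite size_map size_enum_ord.
  by rewrite P -{2}(mkseq_nth 0 (oneline s)) so.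
(* The preimage [w] shows that the choice in [Phi] succeeds, so the default value does not occur. *)
have {w D P} [D P] : dyck_prefix (Phi s) /\ Psi (Phi s) = oneline s.
  rewrite /Phi; case: pickP => [v /andP[Dv /eqP Pv] //|/(_ w)].
  by rewrite D P eqxx.
rewrite nb_right_components_cuts -P nb_cuts_Psi // ?size_tuple //; last first.
  by rewrite -dyck_prefix_from.
rewrite /dyck_path D height_end_from // ret_ret_from //=.
by case: (end_from 0 _) => [|e] /=; lia.
Qed.
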